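(* Consider the noisy HK system (S1) under assumption (A1), and suppose $r_{\min}<1$. Then for every initial state $x(0)\in[0,1]^n$, almost surely $$\overline{d}_{\mathcal V}=2\eta \ \text{ if } \eta\le \tfrac{r_{\min}}{2},\qquad \overline{d}_{\mathcal V}\ge \min\{2\eta,1\}\ \text{ if } \eta>\tfrac{r_{\min}}{2},\qquad \overline{d}_{\mathcal V}=1\ \text{ if } \eta>\max\{\tfrac{r_{\min}}{2},\tfrac{r_{\max}}{n}\}.$$ Moreover, for any constant $\alpha>0$ let $c^1_\alpha=1$ if $\eta>\max\{r_{\min}/2,r_{\max}/n\}$ and $c^1_\alpha=2\eta-\alpha$ otherwise; set $\tau_0=0$ and for $k\ge1$ $$\tau_k=\begin{cases}\min\{s>\tau_{k-1}: d_{\mathcal V}(s)\le\alpha\} & k \text{ odd},\\ \min\{s>\tau_{k-1}: d_{\mathcal V}(s)\ge c^1_\alpha\} & k\text{ even}.\end{cases}$$ Then there are constants $\lambda_1\in(0,1)$ and $\Lambda_1>0$, depending only on $n,\eta,\underline\rho,\alpha$ and $r_1,\dots,r_n$, such that for all $k\ge0$ and $t\ge0$, $$P(\tau_{k+1}-\tau_k>t)\le(1-\lambda_1)^{\lfloor t/\Lambda_1\rfloor}.$$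
   Context: Fix an integer $n\ge3$, agent set $\mathcal V=\{1,\dots,n\}$, confidence thresholds $r_i\in(0,1]$ ($i\in\mathcal V$), $r_{\min}=\min_i r_i$, $r_{\max}=\max_i r_i$, and a noise amplitude $\eta>0$. Opinions $x_i(t)\in[0,1]$, $x(t)=(x_1(t),\dots,x_n(t))$, $t=0,1,2,\dots$, with arbitrary initial state $x(0)\in[0,1]^n$. The neighbor set is $\mathcal N_i(t)=\{j\in\mathcal V:|x_j(t)-x_i(t)|\le r_i\}$ (it contains $i$), $|S|$ is the cardinality of $S$, and $\Pi_{[0,1]}(y)=\min\{1,\max\{0,y\}\}$. Let $d_{\mathcal V}(t)=\max_{i,j\in\mathcal V}|x_i(t)-x_j(t)|$, $\underline d_{\mathcal V}=\liminf_{t\to\infty}d_{\mathcal V}(t)$, $\overline d_{\mathcal V}=\limsup_{t\to\infty}d_{\mathcal V}(t)$. System (S1) (HK model with environment noise): for all $i\in\mathcal V$, $t\ge0$, $x_i(t+1)=\Pi_{[0,1]}\big(|\mathcal N_i(t)|^{-1}\sum_{j\in\mathcal N_i(t)}x_j(t)+\xi_i(t)\big)$, where $\xi_i(t)\in[-\eta,\eta]$ are random noises (possibly correlated). Assumption (A1): there is a constant $\underline\rho>0$ such that for every $t\ge0$, conditionally on the history (i.e. given any states $x(0),\dots,x(t)\in[0,1]^n$), $P\big(\bigcap_{i=1}^n\{\xi_i(t)\in[a_i,b_i]\}\,\big|\,x(0),\dots,x(t)\big)\ge\underline\rho\prod_{i=1}^n(b_i-a_i)$ for all reals $-\eta\le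 a_i<b_i\le\eta$. *)

(* Defs.v *)
From HB Require Import structures.
From mathcomp Require Import all_boot all_order all_algebra.
From mathcomp Require Import all_classical all_reals all_analysis.
Set Implicit Arguments. Unset Strict Implicit. Unset Printing Implicit Defensive.
Import Order.TTheory GRing.Theory Num.Theory.
Local Open Scope classical_set_scope.
Local Open Scope ring_scope.

Section HK.
Variable R : realType.
Variable n : nat.

Definition proj01 (y : R) : R := Num.min 1 (Num.max 0 y).

Definition nbr (r : 'I_n -> R) (x : 'I_n -> R) (i : 'I_n) : {set 'I_n} :=
  [set j | `|x j - x i| <= r i].

Definition hk_avg (r : 'I_n -> R) (x : 'I_n -> R) (i : 'I_n) : R :=
  (\sum_(j in nbr r x i) x j) / #|nbr r x i|%:R.

Fixpoint hk_traj {Omega : Type} (r : 'I_n -> R) (x0 : 'I_n -> R)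
  (xi : nat -> 'I_n -> Omega -> R) (t : nat) (w : Omega) : 'I_n -> R :=
  match t with
  | 0%N => x0
  | s.+1 => fun i => proj01 (hk_avg r (hk_traj r x0 xi s w) i + xi s i w)
  end.

Definition diam (x : 'I_n -> R) : R :=
  \big[Num.max/0]_(i < n) \big[Num.max/0]_(j < n) `|x i - x j|.

Definition rmin (r : 'I_n -> R) : R := \big[Num.min/1]_(i < n) r i.
Definition rmax (r : 'I_n -> R) : R := \big[Num.max/0]_(i < n) r i.

Definition history_gen {Omega : Type} (X : nat -> Omega -> 'I_n -> R) (t : nat)
  : set (set Omega) :=
  [set A | exists s i (B : set R), (s <= t)%N /\ measurable B /\
           A = (fun w => X s w i) @^-1` B].

Definition history_events {Omega : Type} (X : nat -> Omega -> 'I_n -> R)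
  (t : nat) : set (set Omega) :=
  <<s history_gen X t >>.

End HK.

(* Assumption (A1): conditionally on the history x(0..t), the joint law of
   xi(t) has density >= rho on [-eta,eta]^n (stated for every event H of the
   history sigma-algebra, the standard meaning of an a.s. conditional bound) *)
Definition assumption_A1 (R : realType) (n : nat) (d : measure_display)
  (Omega : measurableType d) (P : probability Omega R)
  (r : 'I_n -> R) (x0 : 'I_n -> R) (xi : nat -> 'I_n -> Omega -> R)
  (eta rho : R) : Prop :=
  forall (t : nat) (H : set Omega) (a b : 'I_n -> R),
    history_events (hk_traj r x0 xi) t H ->
    (forall i, - eta <= a i /\ a i < b i /\ b i <= eta) ->
    ((rho * \prod_(i < n) (b i - a i))%:E * P H <=
      P (H `&` [set w | forall i, (a i <= xi t i w <= b i)%R]))%E.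

(* first time s > m with p s (None = +infinity) *)
Definition first_after (p : nat -> Prop) (m : nat) : option nat :=
  match pselect (exists s, (m < s)%N /\ p s) with
  | left h =>
      Some (@ex_minn (fun s => (m < s)%N && `[< p s >])
              (let: ex_intro s hs := h in
               ex_intro _ s (introT andP (conj (proj1 hs) (asboolT (proj2 hs))))))
  | right _ => None
  end.

Fixpoint tau {R : realType} (dd : nat -> R) (alpha c : R) (k : nat) : option nat :=
  match k with
  | 0%N => Some 0%N
  | k'.+1 =>
      match tau dd alpha c k' with
      | None => None
      | Some m =>
          if odd k'.+1 then first_after (fun s => dd s <= alpha) m
          else first_after (fun s => c <= dd s) m
      end
  end.

(* the event {tau_{k+1} - tau_k > t}, with the convention infinity - m = infinity *)
Definition gap_gt {R : realType} (a b : option nat) (t : R) : Prop :=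
  match a, b with
  | Some ta, Some tb => t < (tb%:R - ta%:R)
  | _, None => True
  | None, Some _ => True
  end.

(* Main.v *)
Require Import Defs.
From HB Require Import structures.
From mathcomp Require Import all_boot all_order all_algebra.
From mathcomp Require Import all_classical all_reals all_analysis.
From mathcomp Require Import measurable_realfun lra zify.
Import Order.TTheory GRing.Theory Num.Theory.
Local Open Scope classical_set_scope.
Local Open Scope ring_scope.

(** Whatever the current state, a fixed finite sequence of noise boxes of
    positive volume forces the next event of interest; the projection onto
    [[0, 1]] makes such open-loop steering robust.

    - Noises in [[-eta, -eta/2]] bring every agent exactly to 0 in finitely many
      steps, so the diameter vanishes.
    - If [2 eta <= 1], small positive noises then bring all agents close to
      [1/2], and one last step sends a chosen agent up and the others down, which
      gives a diameter arbitrarily close to [2 eta].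
    - If [eta > rmin/2] and [eta > rmax/n], lift all agents from 0 to slightly
      below [eta], then send an agent with threshold [rmin] up and the others
      back to exactly 0. The gap exceeds [rmin], so that agent sees only itself
      and climbs to 1, while each other agent averages to at most [rmax/n < eta]
      and can be kept at 0: the diameter becomes 1.

    By (A1), conditionally on any past each of these events thus occurs within
    [L] steps with probability at least [q], with [q] and [L] depending only on
    the parameters. This yields geometric tails for the waiting times between
    stopping times, and infinite recurrence. Finally, a diameter at most
    [2 eta <= rmin] persists, since then all agents compute the same average. *)

(** * Steering the deterministic dynamics *)

Section deterministic.
Context {R : realType} {n : nat}.
Implicit Types (r x y lo hi z a b : 'I_n -> R) (i j : 'I_n).

Lemma archi_lt_natM (c e : R) : 0 < e -> exists K : nat, c < K.+1%:R * e.
Proof.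
by move=> e0; exists (Num.truncn (c / e)); rewrite -ltr_pdivrMr// truncnS_gt.
Qed.

Lemma proj01_ge0 (y : R) : 0 <= proj01 y.
Proof. by rewrite /proj01 le_min ler01 le_max lexx. Qed.

Lemma proj01_le1 (y : R) : proj01 y <= 1.
Proof. by rewrite /proj01 ge_min lexx. Qed.

Lemma proj01_ge (l y : R) : l <= 1 -> l <= y -> l <= proj01 y.
Proof. by move=> l1 ly; rewrite /proj01 le_min l1 le_max ly orbT. Qed.

Lemma proj01_le (h y : R) : 0 <= h -> y <= h -> proj01 y <= h.
Proof. by move=> h0 yh; rewrite /proj01 ge_min ge_max h0 yh orbT. Qed.

Lemma proj01_lip (y y' : R) : `|proj01 y - proj01 y'| <= `|y - y'|.
Proof.
wlog le_yy' : y y' / y <= y'.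
  by move=> W; case/orP: (le_total y y') => /W //; rewrite distrC (distrC y).
have : proj01 y <= proj01 y' <= proj01 y + (y' - y).
  rewrite /proj01 !minEle !maxEle.
  by repeat case: ifPn; rewrite -?ltNge => *; apply/andP; split; lra.
by move=> ?; rewrite !ler0_norm; lra.
Qed.

Lemma nbr_self r x i : 0 < r i -> i \in nbr r x i.
Proof. by move=> r0; rewrite inE subrr normr0 ltW. Qed.

Lemma card_nbr_gt0 r x i : 0 < r i -> (0 < #|nbr r x i|)%N.
Proof. by move=> r0; apply/card_gt0P; exists i; exact: nbr_self. Qed.

Lemma hk_avg_ge r x i (c : R) : 0 < r i -> (forall j, c <= x j) ->
  c <= hk_avg r x i.
Proof.
move=> r0 cx; have n0 := card_nbr_gt0 r x i r0.
rewrite /hk_avg ler_pdivlMr ?ltr0n// mulr_natr -sumr_const.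
exact: ler_sum.
Qed.

Lemma hk_avg_le r x i (c : R) : 0 < r i -> (forall j, x j <= c) ->
  hk_avg r x i <= c.
Proof.
move=> r0 cx; have n0 := card_nbr_gt0 r x i r0.
rewrite /hk_avg ler_pdivrMr ?ltr0n// mulr_natr -sumr_const.
exact: ler_sum.
Qed.

Lemma hk_avg_isolated r x i : 0 < r i ->
  (forall j, j != i -> r i < `|x j - x i|) -> hk_avg r x i = x i.
Proof.
move=> r0 far; rewrite /hk_avg.
have -> : nbr r x i = [set i]%SET.
  apply/setP => j; rewrite !inE; case: eqVneq => [->|/far/lt_geF//].
  by rewrite subrr normr0 ltW.
by rewrite big_set1 cards1 divr1.
Qed.

(* The visible outlier is averaged with all n agents, hence the threshold
   rmax / n. *)
Lemma hk_avg_outlier r x i j : 0 < r j -> j != i -> 0 <= x i ->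
  (forall k, k != i -> x k = 0) -> hk_avg r x j <= r j / n%:R.
Proof.
move=> r0 ji xi0 x0.
have n0 : 0 < n%:R :> R by rewrite ltr0n; apply: leq_ltn_trans (ltn_ord j).
have xj0 : x j = 0 by exact: x0.
rewrite /hk_avg; case: (leP `|x i - x j| (r j)) => [near|far].
  have -> : nbr r x j = [set: 'I_n]%SET.
    apply/setP => k; rewrite !inE; case: (eqVneq k i) => [->//|/x0 ->].
    by rewrite xj0 subrr normr0 ltW.
  rewrite cardsT card_ord ler_pM2r ?invr_gt0// (bigD1 i) ?inE//= big1 ?addr0.
    by move: near; rewrite xj0 subr0 ger0_norm.
  by move=> k /andP[_ /x0].
rewrite big1 ?mul0r; first by rewrite divr_ge0// ltW.
move=> k; rewrite inE; case: (eqVneq k i) => [->|/x0//].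
by rewrite leNgt far.
Qed.

Lemma diam_ge x i j : `|x i - x j| <= diam x.
Proof.
rewrite /diam; apply: le_trans (le_bigmax _ _ i).
exact: (le_bigmax _ (fun j => `|x i - x j|) j).
Qed.

Lemma diam_le x (c : R) : 0 <= c -> (forall i j, `|x i - x j| <= c) ->
  diam x <= c.
Proof.
by move=> c0 xc; apply: bigmax_le => // i _; apply: bigmax_le => // j _.
Qed.

Lemma diam_ge0 x : 0 <= diam x.
Proof. exact: bigmax_ge_id. Qed.

Lemma diam_le1 x : (forall i, 0 <= x i <= 1) -> diam x <= 1.
Proof.
move=> x01; apply: diam_le => // i j; have := x01 i; have := x01 j.
by rewrite ler_norml; lra.
Qed.

Lemma rmin_le r i : rmin r <= r i.
Proof. exact: bigmin_le. Qed.

Lemma rmax_ge r i : r i <= rmax r.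
Proof. exact: (le_bigmax _ r i). Qed.

(** The default value 1 of the iterated minimum exceeds [rmin r], so the minimum must come from an
    agent. *)
Lemma rmin_attained r : rmin r < 1 -> exists i, r i = rmin r.
Proof.
move=> r1; apply: contrapT => nex.
suff : rmin r < rmin r by rewrite ltxx.
rewrite {2}/rmin; apply: lt_bigmin => // i _.
rewrite lt_neqAle rmin_le andbT; apply/eqP => e; apply: nex.
by exists i.
Qed.

(** Convertible with the successor case of [hk_traj], so deterministic facts transfer to
    trajectories directly. *)
Definition hk_next r x z : 'I_n -> R := fun i => proj01 (hk_avg r x i + z i).

(** Every agent sees all the others, so the averages coincide and only two noises differ; the
    projection is 1-Lipschitz. *)
Lemma hk_next_diam r x z (eta : R) : (forall i, 0 < r i) ->
  0 <= eta -> (forall i, - eta <= z i <= eta) ->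
  diam x <= rmin r -> diam (hk_next r x z) <= 2 * eta.
Proof.
move=> r0 eta0 zeta dx.
have nT i : nbr r x i = [set: 'I_n]%SET.
  apply/setP => j; rewrite !inE.
  exact: le_trans (diam_ge x j i) (le_trans dx (rmin_le r i)).
apply: diam_le => [|i j]; first lra.
apply: (le_trans (proj01_lip _ _)).
rewrite /hk_avg !nT ler_norml; have := zeta i; have := zeta j; lra.
Qed.

Definition box (lo hi : 'I_n -> R) : set ('I_n -> R) :=
  [set x | forall i, lo i <= x i <= hi i].

(* [robust_reach r eta L lo hi lo' hi']: a sequence of [L] noise boxes of
   positive volume, fixed in advance, drives every state of [box lo hi] into
   [box lo' hi']. *)
Inductive robust_reach (r : 'I_n -> R) (eta : R) : nat ->
  ('I_n -> R) -> ('I_n -> R) -> ('I_n -> R) -> ('I_n -> R) -> Prop :=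
| robust_reach0 lo hi lo' hi' : box lo hi `<=` box lo' hi' ->
    robust_reach r eta 0 lo hi lo' hi'
| robust_reachS L lo hi lo1 hi1 lo' hi' a b :
    (forall i, - eta <= a i /\ a i < b i /\ b i <= eta) ->
    (forall x z, box lo hi x -> box a b z -> box lo1 hi1 (hk_next r x z)) ->
    robust_reach r eta L lo1 hi1 lo' hi' ->
    robust_reach r eta L.+1 lo hi lo' hi'.

Lemma robust_reach_sub r eta L lo hi lo1 hi1 lo' hi' :
  box lo hi `<=` box lo1 hi1 -> robust_reach r eta L lo1 hi1 lo' hi' ->
  robust_reach r eta L lo hi lo' hi'.
Proof.
move=> sub reach; case: reach sub => {lo1 hi1 lo' hi' L}.
  by move=> lo1 hi1 lo' hi' sub' sub; apply: robust_reach0 => x /sub /sub'.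
move=> L lo1 hi1 lo2 hi2 lo' hi' a b ab step reach sub.
by apply: robust_reachS reach; [exact: ab | move=> x z /sub; exact: step].
Qed.

Lemma robust_reach_trans r eta L L' lo hi lo1 hi1 lo' hi' :
  robust_reach r eta L lo hi lo1 hi1 -> robust_reach r eta L' lo1 hi1 lo' hi' ->
  robust_reach r eta (L + L') lo hi lo' hi'.
Proof.
move=> reach; elim: reach lo' hi' => {L lo hi lo1 hi1}.
  by move=> lo hi lo1 hi1 sub lo' hi'; exact: robust_reach_sub.
move=> L lo hi lo1 hi1 lo2 hi2 a b ab step _ IH lo' hi' reach.
by apply: robust_reachS (IH _ _ reach).
Qed.

(** For phases that repeat one noise box while the box containing the state moves with [k]. *)
Lemma robust_reach_iter r eta (K : nat) (lo hi : nat -> 'I_n -> R) a b :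
  (forall i, - eta <= a i /\ a i < b i /\ b i <= eta) ->
  (forall k x z, (k < K)%N -> box (lo k) (hi k) x -> box a b z ->
    box (lo k.+1) (hi k.+1) (hk_next r x z)) ->
  robust_reach r eta K (lo 0%N) (hi 0%N) (lo K) (hi K).
Proof.
move=> ab; elim: K lo hi => [|K IH] lo hi step; first exact: robust_reach0.
apply: (robust_reachS _ _ _ _ _ (lo 1%N) (hi 1%N) _ _ a b) => //.
  by move=> x z; exact: step.
by apply: (IH (fun k => lo k.+1) (fun k => hi k.+1)) => k x z kK; exact: step.
Qed.

(** Averaging never raises the maximum, so each step lowers the upper bound by at least [eta / 2],
    until the projection holds everyone at exactly 0. *)
Lemma robust_reach_zero r (eta : R) : (forall i, 0 < r i) -> 0 < eta ->
  exists K, robust_reach r eta K.+1 (fun=> 0) (fun=> 1) (fun=> 0) (fun=> 0).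
Proof.
move=> r_gt0 eta_gt0.
have [K K1] := archi_lt_natM 1 (eta / 2) (divr_gt0 eta_gt0 (ltr0Sn _ 1)).
exists K.
pose hi k := fun _ : 'I_n => Num.max 0 (1 - k%:R * (eta / 2)).
have := robust_reach_iter r eta K.+1 (fun _ _ => 0) hi
  (fun=> - eta) (fun=> - (eta / 2)).
have -> : hi 0%N = fun=> 1.
  by apply/funext => i; rewrite /hi mul0r subr0 max_r.
have -> : hi K.+1 = fun=> 0.
  by apply/funext => i; rewrite /hi max_l// ltW// subr_lt0.
apply => [i|k x z _ bx bz i]; first by (split; [|split]) => /=; lra.
rewrite /hk_next proj01_ge0/=; apply: proj01_le; first by rewrite /hi le_max lexx.
have avg : hk_avg r x i <= hi k i.
  by apply: hk_avg_le => // j; have /andP[] := bx j.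
have /andP[_ zi] := bz i.
apply: le_trans (lerD avg zi) _; rewrite /hi -(natr1 k).
rewrite le_max; case: (leP 0 (1 - k%:R * (eta / 2))) => _; apply/orP.
  by right; lra.
by left; lra.
Qed.

(** All agents gather in [[1/2 - be, 1/2]], then one step separates [i0] from the rest. As
    [2 * eta <= 1], the projection does not cut the final move; the gap between the two target boxes
    is [2 * eta - 3 * be]. *)
Lemma robust_reach_split r (eta : R) i0 (be : R) :
  (forall i, 0 < r i) -> 0 < eta ->
  2 * eta <= 1 -> 0 < be -> be <= 1 / 4 -> be <= eta ->
  exists K, robust_reach r eta K.+1 (fun=> 0) (fun=> 0)
    (fun i => if i == i0 then 1 / 2 + eta - 2 * be else 0)
    (fun i => if i == i0 then 1 else 1 / 2 - eta + be).
Proof.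
move=> r_gt0 eta_gt0 eta1 be0 be4 beeta.
(* This [J] makes the increment [1 / 2 / J] at most [eta], hence an admissible noise. *)
have [J' JP] := archi_lt_natM (1 / 2) eta eta_gt0.
set J := J'.+1 in JP; exists J.
have J0 : 0 < J%:R :> R by rewrite ltr0n.
pose lo k := fun _ : 'I_n => k%:R * ((1 / 2 - be) / J%:R).
pose hi k := fun _ : 'I_n => k%:R * (1 / 2 / J%:R) : R.
have gather : robust_reach r eta J (fun=> 0) (fun=> 0)
    (fun=> 1 / 2 - be) (fun=> 1 / 2).
  have := robust_reach_iter r eta J lo hi
    (fun=> (1 / 2 - be) / J%:R) (fun=> 1 / 2 / J%:R).
  have -> : lo 0%N = fun=> 0 by apply/funext => i; rewrite /lo mul0r.
  have -> : hi 0%N = fun=> 0 by apply/funext => i; rewrite /hi mul0r.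
  have -> : lo J = fun=> 1 / 2 - be.
    by apply/funext => i; rewrite /lo mulrCA mulfV ?mulr1// gt_eqF.
  have -> : hi J = fun=> 1 / 2.
    by apply/funext => i; rewrite /hi mulrCA mulfV ?mulr1// gt_eqF.
  apply => [_|k x z kJ bx bz i].
    split; [|split].
    - by apply: (@le_trans _ _ 0); [lra | apply: divr_ge0; lra].
    - by rewrite ltr_pM2r ?invr_gt0//; lra.
    - by rewrite ler_pdivrMr// mulrC; lra.
  have kJ1 : k.+1%:R / J%:R <= 1 :> R by rewrite ler_pdivrMr// mul1r ler_nat.
  have kJ0 : 0 <= k.+1%:R / J%:R :> R by rewrite divr_ge0.
  have /andP[z1 z2] := bz i.
  have avg1 : lo k i <= hk_avg r x i.
    by apply: hk_avg_ge => // j; have /andP[] := bx j.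
  have avg2 : hk_avg r x i <= hi k i.
    by apply: hk_avg_le => // j; have /andP[] := bx j.
  rewrite /hk_next; apply/andP; split.
    apply: proj01_ge.
      by rewrite /lo mulrCA; apply: mulr_ile1 => //; lra.
    by apply: le_trans (lerD avg1 z1); rewrite /lo -(natr1 k) (mulrDl k%:R) !mul1r.
  apply: proj01_le; first by rewrite /hi mulr_ge0// divr_ge0//; lra.
  by apply: le_trans (lerD avg2 z2) _; rewrite /hi -(natr1 k) (mulrDl k%:R) !mul1r.
(* The extra step is the separation: [i0] gets noise near [eta], the others noise near [- eta]. *)
rewrite -addn1; apply: robust_reach_trans gather _.
pose a i := if i == i0 then eta - be else - eta.
pose b i := if i == i0 then eta else - eta + be.
apply: (robust_reachS _ _ _ _ _ _ _ _ _ a b _ _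
  (robust_reach0 _ _ _ _ _ _ (@subset_refl _ _))).
  by move=> i; rewrite /a /b; case: ifP => _; (split; [|split]); lra.
move=> x z bx bz i; rewrite /hk_next; have := bz i.
have avg1 : 1 / 2 - be <= hk_avg r x i.
  by apply: hk_avg_ge => // j; have /andP[] := bx j.
have avg2 : hk_avg r x i <= 1 / 2.
  by apply: hk_avg_le => // j; have /andP[] := bx j.
rewrite /a /b; case: ifP => _ /andP[z1 z2].
  by rewrite proj01_le1 andbT; apply: proj01_ge; lra.
by rewrite proj01_ge0/=; apply: proj01_le; lra.
Qed.

Lemma robust_reach_escape r (eta : R) i0 :
  (forall i, 0 < r i) -> 0 < eta ->
  r i0 < 1 -> r i0 / 2 < eta -> rmax r / n%:R < eta ->
  exists K, robust_reach r eta K.+1 (fun=> 0) (fun=> 0)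
    (fun i => if i == i0 then 1 else 0) (fun i => if i == i0 then 1 else 0).
Proof.
move=> r_gt0 eta_gt0 ri1 ri_eta rmax_eta.
have n0 : 0 < n%:R :> R by rewrite ltr0n; apply: leq_ltn_trans (ltn_ord i0).
(* [de] is a quarter of the smallest of three positive margins, so one slack serves all later
   estimates. *)
have [de [de0 de1 de2 de3]] : exists de : R, [/\ 0 < de, 4 * de <= eta,
    4 * de <= eta - rmax r / n%:R & 4 * de <= 2 * eta - r i0].
  pose m := Num.min eta (Num.min (eta - rmax r / n%:R) (2 * eta - r i0)).
  have m0 : 0 < m by rewrite !lt_min eta_gt0; lra.
  have : m <= m by [].
  by rewrite {2}/m !le_min => /and3P[? ? ?]; exists (m / 4); split; lra.
(* [c] bounds [i0] from below after the separation: a lift of at least [eta - 2 * de], then noise of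
   at least [eta - de], cut at 1 by the projection. It exceeds [r i0], so [i0] will see only
   itself. *)
pose c := Num.min 1 (2 * eta - 3 * de).
have ri_c : r i0 < c by rewrite lt_min ri1; lra.
have c1 : c <= 1 by rewrite ge_min lexx.
pose aup i := if i == i0 then eta - de else - eta.
pose bup i := if i == i0 then eta else - eta + de.
have ab i : - eta <= aup i /\ aup i < bup i /\ bup i <= eta.
  by rewrite /aup /bup; case: ifP => _; (split; [|split]) => /=; lra.
pose lo k i := if i == i0 then Num.min 1 (c + k%:R * (eta - de)) else 0.
pose hi (_ : nat) i := if i == i0 then 1 else 0 : R.
have [K' KP] : exists K, 1 < K.+1%:R * (eta - de) by apply: archi_lt_natM; lra.
set K := K'.+1 in KP; exists K.+1.
(* Lift: staying below [eta - de] lets the next noise, at most [- eta + de], return every agent but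
   [i0] to exactly 0. *)
apply: (robust_reachS _ _ _ _ _ (fun=> Num.min 1 (eta - 2 * de))
  (fun=> eta - de) _ _ (fun=> eta - 2 * de) (fun=> eta - de)).
- by move=> i; (split; [|split]) => /=; lra.
- move=> x z bx bz i; rewrite /hk_next; have /andP[z1 z2] := bz i.
  have avg1 : 0 <= hk_avg r x i.
    by apply: hk_avg_ge => // j; have /andP[] := bx j.
  have avg2 : hk_avg r x i <= 0.
    by apply: hk_avg_le => // j; have /andP[] := bx j.
  apply/andP; split; last by apply: proj01_le; lra.
  by apply: proj01_ge; rewrite ge_min ?lexx//; apply/orP; right; lra.
apply: (robust_reachS _ _ _ _ _ (lo 0%N) (hi 0%N) _ _ aup bup) => //.
  move=> x z bx bz i; rewrite /hk_next.
  have avg1 : Num.min 1 (eta - 2 * de) <= hk_avg r x i.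
    by apply: hk_avg_ge => // j; have /andP[] := bx j.
  have avg2 : hk_avg r x i <= eta - de.
    by apply: hk_avg_le => // j; have /andP[] := bx j.
  have := bz i; rewrite /aup /bup /lo /hi; case: ifP => _ /andP[z1 z2].
    rewrite proj01_le1 andbT mul0r addr0 min_r//; apply: proj01_ge => //.
    rewrite /c ge_min; move: avg1; rewrite ge_min => /orP[] ?;
      apply/orP; [left|right]; lra.
  by rewrite proj01_ge0/=; apply: proj01_le; lra.
(* After [K] steps the climb of [eta - de] per step has passed 1, so the final box is a single
   state. *)
have loK : lo K = fun i => if i == i0 then 1 else 0.
  apply/funext => i; rewrite /lo; case: ifP => // _; rewrite min_l//.
  by have := r_gt0 i0; lra.
rewrite -[X in robust_reach _ _ _ _ _ X]loK.
apply: (robust_reach_iter r eta K lo hi aup bup) => // k x z _ bx bz i.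
have x0 j : j != i0 -> x j = 0.
  move=> ji; have := bx j; rewrite /lo /hi (negbTE ji) => /andP[? ?].
  by apply/eqP; rewrite eq_le; apply/andP.
have := bx i0; rewrite /lo /hi eqxx => /andP[xlo x1].
have cx : c <= x i0.
  apply: le_trans xlo; rewrite le_min c1/= lerDl mulr_ge0//; lra.
rewrite /hk_next; have := bz i; rewrite /aup /bup.
case: eqVneq => [->|ii0] /andP[z1 z2].
  rewrite proj01_le1 andbT hk_avg_isolated//; last first.
    by move=> j /x0 ->; rewrite sub0r normrN; apply: lt_le_trans (ler_norm _); lra.
  apply: proj01_ge; first by rewrite ge_min lexx.
  rewrite ge_min -(natr1 k) mulrDl mul1r addrA; move: xlo; rewrite ge_min => /orP[] ?;
    apply/orP; [left|right]; lra.
rewrite proj01_ge0/=; apply: proj01_le => //.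
have xi0 : 0 <= x i0 by have := r_gt0 i0; lra.
have := hk_avg_outlier r x i0 i (r_gt0 i) ii0 xi0 x0.
have : r i / n%:R <= rmax r / n%:R by rewrite ler_pM2r ?invr_gt0// rmax_ge.
lra.
Qed.

End deterministic.

(** * Geometric tails of hitting times *)

Lemma first_after_SomeP (p : nat -> Prop) m s :
  first_after p m = Some s <->
  [/\ (m < s)%N, p s & forall j, (m < j < s)%N -> ~ p j].
Proof.
rewrite /first_after; case: pselect => [ex|nex]; last first.
  by split=> // -[ms ps _]; exfalso; apply: nex; exists s.
case: ex_minnP => s0 /andP[ms0 /asboolP ps0] mins0; split.
  move=> [<-]; split=> // j /andP[mj js] pj.
  have : (s0 <= j)%N by apply: mins0; rewrite mj; apply/asboolP.
  by rewrite leqNgt js.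
move=> [ms ps lts]; congr Some; apply/eqP; rewrite eqn_leq.
rewrite mins0 ?ms/=; last exact/asboolP.
by rewrite leqNgt; apply/negP => s0s; apply: (lts s0) => //; rewrite ms0.
Qed.

Lemma first_after_NoneP (p : nat -> Prop) m :
  first_after p m = None <-> (forall j, (m < j)%N -> ~ p j).
Proof.
rewrite /first_after; case: pselect => [ex|nex]; split=> //.
  by case: ex => s [ms ps] /(_ s ms).
by move=> _ j mj pj; apply: nex; exists j.
Qed.

Section filtration.
Context {d : measure_display} {Omega : measurableType d} {R : realType}.
Variables (P : probability Omega R) (G : nat -> set (set Omega)).
Local Notation F t := <<s G t >>.
Hypothesis F_mono : forall s t, (s <= t)%N -> F s `<=` F t.
Hypothesis F_meas : forall t, F t `<=` measurable.

Let F_setI t A B : F t A -> F t B -> F t (A `&` B).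
Proof. exact: (@measurableI _ (g_sigma_algebraType (G t))). Qed.

Let F_setC t A : F t A -> F t (~` A).
Proof. exact: (@measurableC _ (g_sigma_algebraType (G t))). Qed.

(** The window starts at [m + 1], in agreement with the strict inequality in [first_after]. *)
Definition misses (D : nat -> set Omega) (m N : nat) : set Omega :=
  \bigcap_(j in [set j | (m < j <= m + N)%N]) ~` D j.

(** The conditional probability bound in product form, which avoids dividing by [P H]. *)
Definition miss_bound (D : nat -> set Omega) (q : R) (L : nat) : Prop :=
  forall t H, F t H -> (P (H `&` misses D t L) <= (1 - q)%:E * P H)%E.

Definition stopping (T : Omega -> option nat) : Prop :=
  forall m, F m [set w | T w = Some m].

Lemma stopping_None T : stopping T -> measurable [set w | T w = None].
Proof.
move=> T_stop.
have -> : [set w | T w = None] = ~` \bigcup_m [set w | T w = Some m].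
  apply/seteqP; split => w /=; first by move=> TN [m _] /=; rewrite TN.
  by case E : (T w) => [m|//] nT; exfalso; apply: nT; exists m.
by apply: measurableC; apply: bigcupT_measurable => m; exact: F_meas (T_stop m).
Qed.

Definition next_time (D : nat -> set Omega) (T : Omega -> option nat) w :=
  if T w is Some m then first_after (fun s => D s w) m else None.

Lemma misses0 D m : misses D m 0 = setT.
Proof. by apply/seteqP; split => // w _ j /=; lia. Qed.

Lemma missesD D m N N' : misses D m (N + N') = misses D m N `&` misses D (m + N) N'.
Proof.
apply/seteqP; split => [w mw|w [mw mw'] j /= mj].
  by split => j /= mj; apply: mw => /=; lia.
by case: (leqP j (m + N)) => mN; [apply: mw|apply: mw'] => /=; lia.
Qed.

Lemma misses_sub D m N N' : (N <= N')%N -> misses D m N' `<=` misses D m N.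
Proof. by move=> /subnKC <- w; rewrite missesD => -[]. Qed.

Section hitting.
Variable D : nat -> set Omega.
Hypothesis F_D : forall s, F s (D s).

Lemma F_misses m N : F (m + N) (misses D m N).
Proof.
apply: (@bigcap_measurableType _ (g_sigma_algebraType (G (m + N)))) => j /= mj.
by apply: F_setC; apply: (F_mono j) => //; lia.
Qed.

Let meas_misses m N : measurable (misses D m N).
Proof. exact: F_meas (F_misses m N). Qed.

Lemma miss_bound_mono q q' L L' : q' <= q -> (L <= L')%N ->
  miss_bound D q L -> miss_bound D q' L'.
Proof.
move=> qq' LL' mb t H FH; have mH := F_meas _ _ FH.
apply: (@le_trans _ _ ((1 - q)%:E * P H)%E).
  apply: le_trans (mb t H FH); apply: le_measure; rewrite ?inE.
  - exact: measurableI.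
  - exact: measurableI.
  - by apply: setIS; exact: misses_sub.
by apply: lee_wpmul2r => //; rewrite lee_fin lerB.
Qed.

(** A hit at the single time [t + L] suffices; [0 < L] puts that time inside the window. *)
Lemma miss_bound_hit q L : (0 < L)%N ->
  (forall t H, F t H -> (q%:E * P H <= P (H `&` D (t + L)))%E) ->
  miss_bound D q L.
Proof.
move=> L0 hit t H FH; have mH := F_meas _ _ FH.
have mD := F_meas _ _ (F_D (t + L)).
apply: (@le_trans _ _ (P (H `\` D (t + L)))).
  apply: le_measure; rewrite ?inE; [exact: measurableI|exact: measurableD|].
  by move=> w [Hw mw]; split => //; apply: mw => /=; lia.
have fH := fin_num_measure P H mH.
rewrite measureD//; last by rewrite ltey_eq fH.
rewrite EFinB muleBl// mul1e leeB//; exact: hit.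
Qed.

Lemma stopping_next T : stopping T -> stopping (next_time D T).
Proof.
move=> T_stop s.
(* Split by the value [m] of [T]; [(s - m).-1] counts the times strictly between [m] and [s]. *)
have -> : [set w | next_time D T w = Some s] =
    \bigcup_(m in [set m | (m < s)%N])
      ([set w | T w = Some m] `&` D s `&` misses D m (s - m).-1).
  apply/seteqP; split => [w|w [m /= ms [[Tw Dw] mw]]]; rewrite /= /next_time.
    case E : (T w) => [m|//] /first_after_SomeP[ms Ds lts].
    by exists m => //; split => // j /= mj; apply: lts; lia.
  by rewrite Tw; apply/first_after_SomeP; split => // j mj; apply: mw => /=; lia.
apply: (@bigcup_measurable _ (g_sigma_algebraType (G s))) => m /= ms.
apply: F_setI.
  by apply: F_setI => //; apply: (F_mono m); [lia|exact: T_stop].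
by apply: F_mono (F_misses _ _); lia.
Qed.

Variables (q : R) (L : nat).
Hypotheses (q01 : 0 < q < 1) (mb : miss_bound D q L).

Let onemq_ge0 : 0 <= 1 - q. Proof. by case/andP: q01; lra. Qed.

(** Having missed the first [j] blocks is an event of the history at [m + j * L], so it can serve as
    the conditioning event for the next block. *)
Lemma miss_bound_iter j m H : F m H ->
  (P (H `&` misses D m (j * L)) <= ((1 - q) ^+ j)%:E * P H)%E.
Proof.
move=> FH; elim: j => [|j IH].
  by rewrite mul0n misses0 setIT expr0 mul1e.
rewrite mulSn addnC missesD setIA exprS EFinM -muleA.
apply: (le_trans (mb _ _ _)).
  by apply: F_setI; [apply: (F_mono m) => //; lia|exact: F_misses].
by apply: lee_wpmul2l => //; rewrite lee_fin.
Qed.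

Variable T : Omega -> option nat.
Hypotheses (T_stop : stopping T) (T_fin : P [set w | T w = None] = 0%E).

Let meas_T m : measurable [set w | T w = Some m].
Proof. exact: F_meas (T_stop m). Qed.

Let meas_None : measurable [set w | T w = None].
Proof. exact: stopping_None. Qed.

(** The block bound is applied with [H] equal to each event [T = m] and summed: these events are
    disjoint and their total mass is at most 1. *)
Lemma missed_after_T (N j : nat) : (j * L <= N)%N ->
  (P ([set w | T w = None] `|`
      \bigcup_m ([set w | T w = Some m] `&` misses D m N)) <=
   ((1 - q) ^+ j)%:E)%E.
Proof.
move=> jN.
have mB m : measurable ([set w | T w = Some m] `&` misses D m N).
  exact: measurableI.
apply: (@le_trans _ _ (P [set w | T w = None] +
    P (\bigcup_m ([set w | T w = Some m] `&` misses D m N)))%E).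
  exact: measureU2 meas_None (bigcupT_measurable _ mB).
rewrite T_fin add0e.
apply: (le_trans (measure_sigma_subadditive P mB (bigcupT_measurable _ mB)
  (@subset_refl _ _))).
apply: (@le_trans _ _
  (\big[+%E/0%E]_(0 <= m <oo) (((1 - q) ^+ j)%:E * P [set w | T w = Some m]))%E).
  apply: lee_nneseries => // m _.
  apply: le_trans (miss_bound_iter j m _ (T_stop m)).
  apply: le_measure; rewrite ?inE; [exact: mB|exact: measurableI|].
  by apply: setIS; exact: misses_sub.
rewrite nneseriesZl//.
rewrite -measure_semi_bigcup//; last 2 first.
- by move=> a b _ _ [w /= [-> [->]]].
- exact: bigcupT_measurable.
rewrite -[leRHS]mule1; apply: lee_wpmul2l; first by rewrite lee_fin exprn_ge0.
by apply: probability_le1; exact: bigcupT_measurable.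
Qed.

(** Finite gaps are integers, so exceeding the real [t] means exceeding its integer part. By
    convention [T = None] counts as a large gap. *)
Lemma gap_gtE (t : R) : 0 <= t ->
  [set w | gap_gt (T w) (next_time D T w) t] =
  [set w | T w = None] `|`
  \bigcup_m ([set w | T w = Some m] `&` misses D m (Num.truncn t)).
Proof.
move=> t0; apply/seteqP; split => w; rewrite /= /next_time.
  case E : (T w) => [m|]; last by left.
  case E' : (first_after _ m) => [s|] gap; right; exists m => //; split => //.
    move/first_after_SomeP : E' => [ms Ds lts] j /= mj; apply: lts.
    move: gap; rewrite /gap_gt -(natrB _ (ltnW ms)) -(truncn_lt_nat _ t0); lia.
  by move/first_after_NoneP : E' => nD j /= mj; apply: nD; lia.
case=> [->//|[m _ [/= -> mw]]] /=.
case E' : (first_after _ m) => [s|//].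
move/first_after_SomeP : E' => [ms Ds lts].
rewrite /gap_gt -(natrB _ (ltnW ms)) -(truncn_lt_nat _ t0); apply: contrapT => /negP.
by rewrite -leqNgt => st; apply: (mw s) => //=; lia.
Qed.

Lemma gap_gt_bound (t : R) (j : nat) : 0 <= t -> (j * L)%:R <= t ->
  (P [set w | gap_gt (T w) (next_time D T w) t] <= ((1 - q) ^+ j)%:E)%E.
Proof.
move=> t0 jt; rewrite gap_gtE//; apply: missed_after_T.
by rewrite truncn_ge_nat.
Qed.

(** Never hitting implies missing [j] blocks for every [j], and [(1 - q) ^+ j] tends to 0. *)
Lemma next_time_finite : P [set w | next_time D T w = None] = 0%E.
Proof.
have mN := stopping_None _ (stopping_next _ T_stop).
have bnd j : (P [set w | next_time D T w = None] <= ((1 - q) ^+ j)%:E)%E.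
  apply: le_trans (missed_after_T (j * L) j (leqnn _)).
  apply: le_measure; rewrite ?inE//.
    apply: measurableU => //; apply: bigcupT_measurable => m.
    exact: measurableI.
  move=> w; rewrite /= /next_time; case E : (T w) => [m|]; last by left.
  move=> /first_after_NoneP nD; right; exists m => //; split => // i /= mi.
  by apply: nD; lia.
have fN := fin_num_measure P _ mN.
apply/eqP; rewrite eq_le measure_ge0 andbT leNgt; apply/negP.
rewrite -(fineK fN) lte_fin => p0.
have q1 : `|1 - q| < 1.
  by rewrite ger0_norm//; case/andP: q01 => ? ?; lra.
have /cvgr0_norm_lt/(_ _ p0)[N _ /(_ N (leqnn N)) /=] := cvg_expr q1.
have := bnd N; rewrite -(fineK fN) lee_fin => le.
by move=> lt; have := le_lt_trans (le_trans le (ler_norm _)) lt; rewrite ltxx.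
Qed.

End hitting.

Lemma stopping_cst m : stopping (fun=> Some m).
Proof.
move=> s; case: (eqVneq m s) => [->|ms].
  rewrite (_ : [set _ | _] = setT); last by apply/seteqP; split.
  exact: (@measurableT _ (g_sigma_algebraType (G s))).
rewrite (_ : [set _ | _] = set0).
  exact: (@measurable0 _ (g_sigma_algebraType (G s))).
by apply/seteqP; split => // w [] /eqP; rewrite (negbTE ms).
Qed.

(** Finiteness of the hitting time after each constant time [m], followed by a countable union of
    negligible sets. *)
Lemma hit_infinitely_often D q L : (forall s, F s (D s)) -> 0 < q < 1 ->
  miss_bound D q L ->
  {ae P, forall w, forall m, exists2 s, (m < s)%N & D s w}.
Proof.
move=> F_D q01 mb.
have neg m : P.-negligible [set w | next_time D (fun=> Some m) w = None].
  have T0 : P [set w : Omega | Some m = None] = 0%E.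
    by rewrite (_ : [set _ | _] = set0) ?measure0//; apply/seteqP; split.
  exists [set w | next_time D (fun=> Some m) w = None]; split => //.
    exact: stopping_None _ (stopping_next _ F_D _ (stopping_cst m)).
  exact: (next_time_finite D F_D q L q01 mb _ (stopping_cst m) T0).
apply: negligibleS (negligible_bigcup neg) => w /= nio.
apply: contrapT => nN; apply: nio => m.
apply: contrapT => nex; apply: nN; exists m => //=.
by apply/first_after_NoneP => j mj Dj; apply: nex; exists j.
Qed.

End filtration.

(** * The noisy dynamics *)

Section limsup.
Context {R : realType} (u : nat -> R).
Hypothesis u01 : forall k, 0 <= u k <= 1.

Let bounded_u : bounded_fun (u : nat -> R^o).
Proof.
exists 1; split; first exact: num_real.
move=> M M1 k _ /=; case/andP: (u01 k) => u0 u1.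
by rewrite ger0_norm// (le_trans u1 (ltW M1)).
Qed.

Lemma limn_sup_ge_io (c : R) : (forall m, exists2 s, (m < s)%N & c <= u s) ->
  c <= limn_sup u.
Proof.
move=> io; rewrite limn_supE//; apply: lb_le_inf.
  by exists (sups u 0); exists 0%N.
move=> _ [m _ <-]; have [s ms cs] := io m; apply: (le_trans cs).
apply: ub_le_sup; last by exists s => //=; exact: ltnW.
by exists 1 => _ [k _ <-]; case/andP: (u01 k).
Qed.

Lemma limn_sup_le_eventually (c : R) :
  (exists m, forall s, (m <= s)%N -> u s <= c) -> limn_sup u <= c.
Proof.
move=> [m le]; rewrite limn_supE//; apply: (@le_trans _ _ (sups u m)).
  by apply: ge_inf; [exact: bounded_fun_has_lbound_sups|exists m].
by apply: ge_sup => [|_ [s /= ms <-]]; [exists (u m); exists m => /=|exact: le].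
Qed.

End limsup.

(** * Measurability of averages, diameters and boxes *)

Section measurability.
Context {R : realType} {n : nat} {d : measure_display} {T : measurableType d}.
Variables (r : 'I_n -> R) (X : T -> 'I_n -> R).
Hypothesis mX : forall i, measurable_fun setT (fun w => X w i).

Lemma measurable_hk_avg i : measurable_fun setT (fun w => hk_avg r (X w) i).
Proof.
pose c j w := `|X w j - X w i| <= r i.
have mc j : measurable_fun setT (c j).
  apply: measurable_fun_ler => //; apply: measurableT_comp => //.
  exact: measurable_funB.
(* The random neighbor set is encoded by indicators, and the reciprocal of its cardinality by the
   power [-1], covered by [measurable_powR]. *)
have -> : (fun w => hk_avg r (X w) i) =
    (fun w => \sum_(j < n) (if c j w then X w j else 0)) \*
    (fun w => (\sum_(j < n) (if c j w then 1 else 0)) `^ (-1)).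
  apply/funext => w; rewrite /hk_avg /=; congr (_ * _).
    by rewrite big_mkcond/=; apply: eq_bigr => j _; rewrite inE.
  rewrite powR_inv1; last by apply: sumr_ge0 => j _; case: ifP.
  rewrite -big_mkcond/= sumr_const; congr (_^-1); congr (_ *+ _).
  by apply: eq_card => j; rewrite inE.
apply: measurable_funM.
  by apply: measurable_sum => j; exact: measurable_fun_ifT.
have mcard : measurable_fun setT
    (fun w => \sum_(j < n) (if c j w then 1 else 0 : R)).
  by apply: measurable_sum => j; exact: measurable_fun_ifT.
exact: measurableT_comp (measurable_powR (-1)) mcard.
Qed.

Lemma measurable_diam : measurable_fun setT (fun w => diam (X w)).
Proof.
have bigM (f : 'I_n -> T -> R) : (forall i, measurable_fun setT (f i)) ->
    measurable_fun setT (fun w => \big[Num.max/0]_(i < n) f i w).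
  move=> mf; elim: (index_enum _) => [|i s IH].
    by under eq_fun do rewrite big_nil; exact: measurable_cst.
  under eq_fun do rewrite big_cons.
  exact: measurable_maxr.
apply: (bigM _) => i; apply: (bigM _) => j; apply: measurableT_comp => //.
exact: measurable_funB.
Qed.

Lemma measurable_box (lo hi : 'I_n -> R) :
  measurable [set w | box lo hi (X w)].
Proof.
have -> : [set w | box lo hi (X w)] =
    \bigcap_(i in setT) (fun w => X w i) @^-1` `[lo i, hi i].
  apply/seteqP; split => w /= bw i; first by rewrite /= in_itv/=.
  by have := bw i I; rewrite /= in_itv.
apply: fin_bigcap_measurable; first exact: finite_finset.
by move=> i _; rewrite -[X in measurable X]setTI; exact: mX.
Qed.

End measurability.

(** Collects what may vary once [n], [r], [eta] and [rho] are fixed; the constants found later must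
    be uniform over it. *)
Definition hk_setting {R : realType} {n : nat} (r : 'I_n -> R) (eta rho : R)
  {d : measure_display} {Omega : measurableType d} (P : probability Omega R)
  (xi : nat -> 'I_n -> Omega -> R) (x0 : 'I_n -> R) : Prop :=
  [/\ forall i, 0 <= x0 i <= 1,
      forall t i, measurable_fun setT (xi t i),
      forall t i w, - eta <= xi t i w <= eta &
      assumption_A1 P r x0 xi eta rho].

Section process.
Context {R : realType} {n : nat} (r : 'I_n -> R) (eta rho : R).
Context {d : measure_display} {Omega : measurableType d}.
Context (P : probability Omega R) (xi : nat -> 'I_n -> Omega -> R).
Context (x0 : 'I_n -> R).
Hypothesis setting : hk_setting r eta rho P xi x0.
Local Notation X := (hk_traj r x0 xi).
Local Notation G := (history_gen X).
Local Notation F t := <<s G t >>.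

Lemma hk_traj01 t w i : 0 <= X t w i <= 1.
Proof.
case: t => [|t] /=; first by case: setting.
by rewrite proj01_ge0 proj01_le1.
Qed.

Lemma hk_diam01 t w : 0 <= diam (X t w) <= 1.
Proof. by rewrite diam_ge0 diam_le1// => i; exact: hk_traj01. Qed.

Lemma measurable_hk_traj t i : measurable_fun setT (fun w => X t w i).
Proof.
case: setting => _ mxi _ _.
elim: t i => [|t IH] i /=; first exact: measurable_cst.
apply: measurable_minr => //; apply: measurable_maxr => //.
by apply: measurable_funD => //; exact: measurable_hk_avg.
Qed.

Lemma history_mono s t : (s <= t)%N -> F s `<=` F t.
Proof.
move=> st; apply: sub_sigma_algebra2 => A [s' [i [B [s's [mB ->]]]]].
by exists s', i, B; split => //; exact: leq_trans st.
Qed.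

Lemma history_measurable t : F t `<=` measurable.
Proof.
apply: smallest_sub; first exact: sigma_algebra_measurable.
move=> A [s [i [B [st [mB ->]]]]]; rewrite -[X in measurable X]setTI.
exact: measurable_hk_traj.
Qed.

(** With the history sigma-algebra as sample space, the general measurability lemmas produce events
    of the history itself. *)
Lemma history_traj t i :
  measurable_fun setT (fun w : g_sigma_algebraType (G t) => X t w i).
Proof.
move=> _ B mB; rewrite setTI; apply: sub_sigma_algebra.
by exists t, i, B.
Qed.

Lemma history_box t lo hi : F t [set w | box lo hi (X t w)].
Proof.
exact: (measurable_box (T := g_sigma_algebraType (G t)) (X t) (history_traj t)).
Qed.

Lemma history_diam_le t c : F t [set w | diam (X t w) <= c].
Proof.
have := measurable_diam (T := g_sigma_algebraType (G t)) (X t) (history_traj t).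
move=> /(_ measurableT `]-oo, c]%classic (measurable_itv _)); rewrite setTI.
by congr (F t _); apply/seteqP; split => w /=; rewrite in_itv.
Qed.

Lemma history_diam_ge t c : F t [set w | c <= diam (X t w)].
Proof.
have := measurable_diam (T := g_sigma_algebraType (G t)) (X t) (history_traj t).
move=> /(_ measurableT `[c, +oo[%classic (measurable_itv _)); rewrite setTI.
by congr (F t _); apply/seteqP; split => w /=; rewrite in_itv/= andbT.
Qed.

End process.

(** * From steering to conditional probabilities *)

Section reachability.
Context {R : realType} {n : nat} (r : 'I_n -> R) (eta rho : R).
Hypothesis rho_gt0 : 0 < rho.

(** Each step costs a factor [rho] times the volume of its noise box. The product [q] is fixed
    before the probability space is introduced, hence uniform. *)
Lemma robust_reach_prob L lo hi lo' hi' : robust_reach r eta L lo hi lo' hi' ->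
  exists2 q : R, 0 < q &
  forall (d : measure_display) (Omega : measurableType d)
    (P : probability Omega R) xi x0, hk_setting r eta rho P xi x0 ->
  forall t H, history_events (hk_traj r x0 xi) t H ->
  (q%:E * P (H `&` [set w | box lo hi (hk_traj r x0 xi t w)]) <=
   P (H `&` [set w | box lo' hi' (hk_traj r x0 xi (t + L) w)]))%E.
Proof.
elim => {L lo hi lo' hi'} [lo hi lo' hi' sub|L lo hi lo1 hi1 lo' hi' a b ab step _].
  exists 1 => // d Omega P xi x0 S t H FH; rewrite mul1e addn0.
  have mH := history_measurable _ _ _ _ _ _ S _ _ FH.
  have mB l h := history_measurable _ _ _ _ _ _ S _ _
    (history_box r xi x0 t l h).
  apply: le_measure; rewrite ?inE; [exact: measurableI|exact: measurableI|].
  by apply: setIS => w; exact: sub.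
move=> [q q0 reach].
have c0 : 0 < rho * \prod_(i < n) (b i - a i).
  rewrite mulr_gt0//; apply: prodr_gt0 => i _.
  by have [_ [? _]] := ab i; rewrite subr_gt0.
exists (q * (rho * \prod_(i < n) (b i - a i))); first exact: mulr_gt0.
move=> d Omega P xi x0 S t H FH.
have mH := history_measurable _ _ _ _ _ _ S _ _ FH.
have mB s l h := history_measurable _ _ _ _ _ _ S _ _
  (history_box r xi x0 s l h).
have FH' : history_events (hk_traj r x0 xi) t
    (H `&` [set w | box lo hi (hk_traj r x0 xi t w)]).
  apply: (@measurableI _ (g_sigma_algebraType _)) => //.
  exact: history_box.
have [_ mxi _ A1] := S.
(* The first step comes from (A1) at time [t], the remaining [L] from the induction hypothesis at
   [t.+1]. *)
rewrite addnS -addSn.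
apply: le_trans (reach d Omega P xi x0 S t.+1 H _); last first.
  by apply: history_mono FH.
rewrite EFinM -muleA; apply: lee_wpmul2l; first by rewrite lee_fin ltW.
apply: (le_trans (A1 t _ a b FH' ab)).
have mxib : measurable [set w | forall i, a i <= xi t i w <= b i].
  exact: (measurable_box (fun w i => xi t i w) (mxi t)).
apply: le_measure; rewrite ?inE.
- by apply: measurableI => //; exact: measurableI.
- exact: measurableI.
move=> w [[Hw bw] zw]; split => //.
exact: (step (hk_traj r x0 xi t w) (fun i => xi t i w)).
Qed.

(** The starting box is the whole state space, so the condition on the current state disappears. *)
Lemma robust_reach_miss_bound L lo' hi' :
  robust_reach r eta L.+1 (fun=> 0) (fun=> 1) lo' hi' ->
  exists2 q : R, 0 < q < 1 &
  forall (d : measure_display) (Omega : measurableType d)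
    (P : probability Omega R) xi x0, hk_setting r eta rho P xi x0 ->
  forall D : set ('I_n -> R), box lo' hi' `<=` D ->
  let X := hk_traj r x0 xi in
  (forall s, history_events X s [set w | D (X s w)]) ->
  miss_bound P (history_gen X) (fun s => [set w | D (X s w)]) q L.+1.
Proof.
move=> /robust_reach_prob[q0 q0_gt0 reach].
(* The cap [1 / 2] keeps the constant strictly below 1. *)
exists (Num.min q0 (1 / 2)); first by rewrite lt_min gt_min q0_gt0/=; lra.
move=> d Omega P xi x0 S D sub X FD.
have Fmono := history_mono r xi x0.
have Fmeas := history_measurable _ _ _ _ _ _ S.
apply: miss_bound_hit => // t H FH; have mH := Fmeas _ _ FH.
apply: (@le_trans _ _ (q0%:E * P H)%E).
  by apply: lee_wpmul2r => //; rewrite lee_fin ge_min lexx.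
have := reach d Omega P xi x0 S t H FH.
rewrite (_ : [set w | _] = setT) ?setIT; last first.
  by apply/seteqP; split => // w _ i /=; exact: (hk_traj01 _ _ _ _ _ _ S).
move=> /le_trans; apply; apply: le_measure; rewrite ?inE.
- by apply: measurableI => //; exact: Fmeas (history_box _ _ _ _ _ _).
- by apply: measurableI => //; exact: Fmeas (FD _).
- by apply: setIS => w; exact: sub.
Qed.

End reachability.

(** * Targets reached again and again, with uniform constants *)

Section targets.
Context {R : realType} {n : nat} (r : 'I_n -> R) (eta rho : R).

(* [q] and [L] are uniform over all probability spaces, noises and initial states. *)
Definition recurrent (D : set ('I_n -> R)) (q : R) (L : nat) : Prop :=
  forall (d : measure_display) (Omega : measurableType d)
    (P : probability Omega R) (xi : nat -> 'I_n -> Omega -> R) (x0 : 'I_n -> R),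
  hk_setting r eta rho P xi x0 ->
  let X := hk_traj r x0 xi in
  miss_bound P (history_gen X) (fun s => [set w | D (X s w)]) q L.

Hypotheses (r_gt0 : forall i, 0 < r i) (eta_gt0 : 0 < eta) (rho_gt0 : 0 < rho).

Lemma consensus_recurrent (alpha : R) : 0 <= alpha ->
  exists q L, 0 < q < 1 /\ recurrent [set x | diam x <= alpha] q L.+1.
Proof.
move=> alpha0; have [K reach] := robust_reach_zero r eta r_gt0 eta_gt0.
have [q q01 mb] := robust_reach_miss_bound r eta rho rho_gt0 _ _ _ reach.
exists q, K; split => // d Omega P xi x0 S X.
apply: (mb d Omega P xi x0 S [set x | diam x <= alpha]) => [x bx /=|s]; last first.
  exact: history_diam_le.
apply: diam_le => // i j; have x0E k : x k = 0.
  by apply/eqP; rewrite eq_le andbC; exact: bx.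
by rewrite !x0E subrr normr0.
Qed.

(** Prefixing the descent to 0 reduces steering from an arbitrary state to steering from the
    origin. *)
Lemma diam_ge_recurrent_from_zero (c : R) K lo' hi' :
  robust_reach r eta K.+1 (fun=> 0) (fun=> 0) lo' hi' ->
  (forall x, box lo' hi' x -> c <= diam x) ->
  exists q L, 0 < q < 1 /\ recurrent [set x | c <= diam x] q L.+1.
Proof.
move=> reach' sub; have [K0 reach0] := robust_reach_zero r eta r_gt0 eta_gt0.
have reach := robust_reach_trans _ _ _ _ _ _ _ _ _ _ reach0 reach'.
have [q q01 mb] := robust_reach_miss_bound r eta rho rho_gt0 _ _ _ reach.
exists q, (K0 + K.+1)%N; split => // d Omega P xi x0 S X.
by apply: (mb d Omega P xi x0 S [set x | c <= diam x]) => // s;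
  exact: history_diam_ge.
Qed.

Lemma spread_recurrent (i0 i1 : 'I_n) (alpha : R) : i1 != i0 ->
  2 * eta <= 1 -> 0 < alpha ->
  exists q L, 0 < q < 1 /\ recurrent [set x | 2 * eta - alpha <= diam x] q L.+1.
Proof.
move=> i10 eta1 alpha0; have eta0 := eta_gt0.
(* With [3 * be <= alpha], the gap [2 * eta - 3 * be] is at least [2 * eta - alpha]. *)
have [be [be0 be1 be2 be3]] : exists be : R,
    [/\ 0 < be, 3 * be <= alpha, be <= 1 / 4 & be <= eta].
  pose m := Num.min (alpha / 3) (Num.min (1 / 4) eta).
  have : m <= m by [].
  by rewrite {2}/m !le_min => /and3P[? ? ?]; exists m; split => //;
    rewrite ?lt_min ?eta0; lra.
have [K reach] := robust_reach_split r eta i0 be r_gt0 eta_gt0 eta1 be0 be2 be3.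
apply: diam_ge_recurrent_from_zero reach _ => x bx.
apply: le_trans (diam_ge x i0 i1); apply: le_trans (ler_norm _).
have := bx i0; have := bx i1; rewrite eqxx (negbTE i10).
by move=> /andP[? ?] /andP[? ?]; lra.
Qed.

Lemma extreme_recurrent (i0 i1 : 'I_n) : i1 != i0 ->
  r i0 < 1 -> r i0 / 2 < eta -> rmax r / n%:R < eta ->
  exists q L, 0 < q < 1 /\ recurrent [set x | 1 <= diam x] q L.+1.
Proof.
move=> i10 ri1 ri2 rm.
have [K reach] := robust_reach_escape r eta i0 r_gt0 eta_gt0 ri1 ri2 rm.
apply: diam_ge_recurrent_from_zero reach _ => x bx.
apply: le_trans (diam_ge x i0 i1); apply: le_trans (ler_norm _).
have := bx i0; have := bx i1; rewrite eqxx (negbTE i10).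
by move=> /andP[? ?] /andP[? ?]; lra.
Qed.

End targets.

(** * Upper limit of the diameter and gaps between stopping times *)

Section conclusions.
Context {R : realType} {n : nat} (r : 'I_n -> R) (eta rho : R).
Context {d : measure_display} {Omega : measurableType d}.
Context (P : probability Omega R) (xi : nat -> 'I_n -> Omega -> R).
Context (x0 : 'I_n -> R).
Hypothesis setting : hk_setting r eta rho P xi x0.
Local Notation X := (hk_traj r x0 xi).
Local Notation dV w := (fun t => diam (X t w)).

Lemma limn_sup_diam_ge (c q : R) L : 0 < q < 1 ->
  recurrent r eta rho [set x | c <= diam x] q L ->
  {ae P, forall w, c <= limn_sup (dV w)}.
Proof.
move=> q01 rec; have mb := rec d Omega P xi x0 setting.
have io := hit_infinitely_often P (history_gen X) (history_mono r xi x0)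
  (history_measurable _ _ _ _ _ _ setting) _ q L
  (fun s => history_diam_ge r xi x0 s c) q01 mb.
apply: filterS io => w io; apply: limn_sup_ge_io => // k.
exact: hk_diam01 setting k w.
Qed.

Lemma limn_sup_diam_le (q : R) L : (forall i, 0 < r i) -> 0 < eta ->
  2 * eta <= rmin r -> 0 < q < 1 ->
  recurrent r eta rho [set x | diam x <= 2 * eta] q L ->
  {ae P, forall w, limn_sup (dV w) <= 2 * eta}.
Proof.
move=> r0 eta0 eta_r q01 rec; have mb := rec d Omega P xi x0 setting.
have io := hit_infinitely_often P (history_gen X) (history_mono r xi x0)
  (history_measurable _ _ _ _ _ _ setting) _ q L
  (fun s => history_diam_le r xi x0 s (2 * eta)) q01 mb.
apply: filterS io => w io; apply: limn_sup_le_eventually => [k|].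
  exact: hk_diam01 setting k w.
(* One visit below [2 * eta] suffices: [hk_next_diam] preserves the bound forever after. *)
have [m _ /= dm] := io 0%N; exists m => s /subnK <-.
elim: (s - m)%N => [//|k IH]; rewrite addSn.
apply: hk_next_diam => //; [exact: ltW| |exact: le_trans eta_r].
by case: setting.
Qed.

(** Puts [tau] in the form of the hitting lemmas, with a target that depends only on the parity of
    [k]. *)
Lemma tauS (alpha c : R) k :
  (fun w => tau (dV w) alpha c k.+1) =
  next_time (fun s => [set w | if odd k.+1 then diam (X s w) <= alpha
                               else c <= diam (X s w)])
    (fun w => tau (dV w) alpha c k).
Proof.
apply/funext => w; rewrite /next_time [LHS]/= -[~~ odd k]/(odd k.+1).
by case: (tau _ _ _ k) => // m; case: (odd k.+1).
Qed.

Section gaps.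
Variables (alpha c q : R) (L : nat).
Hypotheses (q01 : 0 < q < 1)
  (rec_le : recurrent r eta rho [set x | diam x <= alpha] q L)
  (rec_ge : recurrent r eta rho [set x | c <= diam x] q L).

Let D k s : set Omega :=
  [set w | if odd k.+1 then diam (X s w) <= alpha else c <= diam (X s w)].

Let F_D k s : <<s history_gen X s >> (D k s).
Proof.
rewrite /D; case: (odd k.+1); [exact: history_diam_le|exact: history_diam_ge].
Qed.

Let mb_D k : miss_bound P (history_gen X) (D k) q L.
Proof.
rewrite /D; case: (odd k.+1); [exact: rec_le setting|exact: rec_ge setting].
Qed.

(** Both properties go through one induction, since finiteness of the next time uses both for the
    current one. *)
Lemma tau_stopping_finite k :
  stopping (history_gen X) (fun w => tau (dV w) alpha c k) /\
  P [set w | tau (dV w) alpha c k = None] = 0%E.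
Proof.
elim: k => [|k [IHs IHf]].
  split; first exact: stopping_cst.
  by rewrite (_ : [set _ | _] = set0) ?measure0//; apply/seteqP; split.
split.
  by rewrite tauS; apply: stopping_next => //; [exact: history_mono|exact: F_D].
have := next_time_finite P _ (history_mono r xi x0)
  (history_measurable _ _ _ _ _ _ setting) _ (F_D k) q L q01 (mb_D k) _ IHs IHf.
by move: (tauS alpha c k) => /= <-.
Qed.

Lemma tau_gap_bound k (t : R) (j : nat) : 0 <= t -> (j * L)%:R <= t ->
  (P [set w | gap_gt (tau (dV w) alpha c k) (tau (dV w) alpha c k.+1) t] <=
   ((1 - q) ^+ j)%:E)%E.
Proof.
move=> t0 jt; have [Ts Tf] := tau_stopping_finite k.
have := gap_gt_bound P _ (history_mono r xi x0)
  (history_measurable _ _ _ _ _ _ setting) _ (F_D k) q L q01 (mb_D k) _ Ts Tf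
  t j t0 jt.
by move: (tauS alpha c k) => /= <-.
Qed.

End gaps.
End conclusions.

(** One pair of constants must serve odd and even [k]: the smaller [q] and the longer window. *)
Lemma recurrent_common {R : realType} {n : nat} (r : 'I_n -> R) (eta rho : R)
    (alpha c : R) :
  (exists q L, 0 < q < 1 /\ recurrent r eta rho [set x | diam x <= alpha] q L.+1) ->
  (exists q L, 0 < q < 1 /\ recurrent r eta rho [set x | c <= diam x] q L.+1) ->
  exists q L, [/\ 0 < q < 1,
    recurrent r eta rho [set x | diam x <= alpha] q L.+1 &
    recurrent r eta rho [set x | c <= diam x] q L.+1].
Proof.
move=> [q1 [L1 [/andP[? ?] rec1]]] [q2 [L2 [/andP[? ?] rec2]]].
exists (Num.min q1 q2), (maxn L1 L2); split.
- by apply/andP; rewrite lt_min gt_min; split; apply/andP || apply/orP; tauto.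
- move=> d Omega P xi x0 S X; apply: miss_bound_mono (rec1 _ _ _ _ _ S).
  + exact: history_mono.
  + exact: history_measurable S.
  + by move=> s; exact: history_diam_le.
  + by rewrite ge_min lexx.
  + by rewrite ltnS leq_maxl.
- move=> d Omega P xi x0 S X; apply: miss_bound_mono (rec2 _ _ _ _ _ S).
  + exact: history_mono.
  + exact: history_measurable S.
  + by move=> s; exact: history_diam_ge.
  + by rewrite ge_min lexx orbT.
  + by rewrite ltnS leq_maxr.
Qed.

Theorem theorem1 (R : realType) (n : nat) (r : 'I_n -> R) (eta rho : R) :
  (3 <= n)%N ->
  (forall i, 0 < r i <= 1) ->
  0 < eta -> 0 < rho ->
  rmin r < 1 ->
  (forall (d : measure_display) (Omega : measurableType d)
          (P : probability Omega R) (xi : nat -> 'I_n -> Omega -> R)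
          (x0 : 'I_n -> R),
     (forall i, 0 <= x0 i <= 1) ->
     (forall t i, measurable_fun setT (xi t i)) ->
     (forall t i w, - eta <= xi t i w <= eta) ->
     assumption_A1 P r x0 xi eta rho ->
     let dV := fun (w : Omega) (t : nat) => diam (hk_traj r x0 xi t w) in
     (eta <= rmin r / 2 ->
        {ae P, forall w, limn_sup (dV w) = 2 * eta}) /\
     (rmin r / 2 < eta ->
        {ae P, forall w, Num.min (2 * eta) 1 <= limn_sup (dV w)}) /\
     (Num.max (rmin r / 2) (rmax r / n%:R) < eta ->
        {ae P, forall w, limn_sup (dV w) = 1})) /\
  (forall alpha : R, 0 < alpha ->
     let c1 := if Num.max (rmin r / 2) (rmax r / n%:R) < eta then 1
               else 2 * eta - alpha in
     exists lambda1 Lambda1 : R,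
       0 < lambda1 < 1 /\ 0 < Lambda1 /\
       forall (d : measure_display) (Omega : measurableType d)
              (P : probability Omega R) (xi : nat -> 'I_n -> Omega -> R)
              (x0 : 'I_n -> R),
         (forall i, 0 <= x0 i <= 1) ->
         (forall t i, measurable_fun setT (xi t i)) ->
         (forall t i w, - eta <= xi t i w <= eta) ->
         assumption_A1 P r x0 xi eta rho ->
         let dV := fun (w : Omega) (t : nat) => diam (hk_traj r x0 xi t w) in
         forall (k : nat) (t : R), 0 <= t ->
           (P [set w | gap_gt (tau (dV w) alpha c1 k) (tau (dV w) alpha c1 k.+1) t]
            <= ((1 - lambda1) ^ (Num.floor (t / Lambda1)))%:E)%E).
Proof.
move=> n3 r01 eta0 rho0 rmin1.
have r0 i : 0 < r i by case/andP: (r01 i).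
have [i0 ri0] := rmin_attained r rmin1.
have [i1 i10] : exists i1, i1 != i0.
  apply: contrapT => nex; suff : (#|'I_n| <= 1)%N by rewrite card_ord; lia.
  have E x : x = i0 by apply: contrapT => /eqP xi0; apply: nex; exists x.
  by apply/card_le1_eqP => x y _ _; rewrite (E x) (E y).
have rmax1 : rmax r <= 1 by apply: bigmax_le => // i _; case/andP: (r01 i).
have rmax0 : 0 <= rmax r by apply: bigmax_ge_id.
have rmaxn : rmax r / n%:R <= 1 / 2.
  apply: (@le_trans _ _ (1 / n%:R)).
    by rewrite ler_pM2r// invr_gt0 ltr0n; lia.
  by rewrite !mul1r lef_pV2 ?posrE ?ltr0n ?ler_nat//; lia.
(* Outside the extreme regime [eta] is at most [rmin r / 2] or [rmax r / n], both at most [1 / 2],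
   so the gathering strategy is available. *)
have small : ~~ (Num.max (rmin r / 2) (rmax r / n%:R) < eta) -> 2 * eta <= 1.
  by rewrite -leNgt le_max => /orP[] ?; lra.
have extreme : Num.max (rmin r / 2) (rmax r / n%:R) < eta ->
    exists q L, 0 < q < 1 /\ recurrent r eta rho [set x | 1 <= diam x] q L.+1.
  rewrite gt_max => /andP[? ?].
  by apply: (extreme_recurrent r eta rho r0 eta0 rho0 i0 i1) => //; rewrite ri0.
have spread (alpha : R) : 2 * eta <= 1 -> 0 < alpha -> exists q L,
    0 < q < 1 /\ recurrent r eta rho [set x | 2 * eta - alpha <= diam x] q L.+1.
  exact: (spread_recurrent r eta rho r0 eta0 rho0 i0 i1 alpha i10).
split.
  move=> d Omega P xi x0 x001 mxi xieta A1 dV.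
  have S : hk_setting r eta rho P xi x0 by [].
  have ge2eta : 2 * eta <= 1 -> {ae P, forall w, 2 * eta <= limn_sup (dV w)}.
    move=> eta1.
    (* The exact bound [2 * eta] is the limit of countably many almost sure bounds with losses
       [1 / (k + 1)]. *)
    have ae k : {ae P, forall w, 2 * eta - k.+1%:R^-1 <= limn_sup (dV w)}.
      have [|q [L [q01 rec]]] := spread k.+1%:R^-1 eta1.
        by rewrite invr_gt0 ltr0n.
      exact: limn_sup_diam_ge S _ _ _ q01 rec.
    apply: filterS (ae_foralln ae) => w aew.
    apply/ler_addgt0Pr => e e0.
    have [k ke] := archi_lt_natM 1 e e0.
    have : k.+1%:R^-1 <= e by rewrite -[leLHS]mul1r ler_pdivrMr ?ltr0n// mulrC ltW.
    by have := aew k; move: (k.+1%:R^-1) => z; lra.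
  have eq1 : Num.max (rmin r / 2) (rmax r / n%:R) < eta ->
      {ae P, forall w, limn_sup (dV w) = 1}.
    move=> /extreme[q [L [q01 rec]]].
    apply: filterS (limn_sup_diam_ge r eta rho P xi x0 S _ _ _ q01 rec) => w ge1.
    apply/eqP; rewrite eq_le ge1 andbT; apply: limn_sup_le_eventually => [k|].
      exact: hk_diam01 S k w.
    by exists 0%N => s _; case/andP: (hk_diam01 r eta rho P xi x0 S s w).
  split; [|split=> //].
    move=> eta_r.
    have le : {ae P, forall w, limn_sup (dV w) <= 2 * eta}.
      have [|q [L [q01 rec]]] := consensus_recurrent r eta rho r0 eta0 rho0 (2 * eta).
        by lra.
      by apply: (limn_sup_diam_le r eta rho P xi x0 S q L.+1) => //; lra.
    have ge : {ae P, forall w, 2 * eta <= limn_sup (dV w)} by apply: ge2eta; lra.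
    apply: filterS2 le ge => w le ge.
    by apply/eqP; rewrite eq_le le ge.
  (* Either the upper limit is 1, or [2 * eta <= 1] and the bound [2 * eta] applies. *)
  move=> _; case: (boolP (Num.max (rmin r / 2) (rmax r / n%:R) < eta)).
    by move=> /eq1; apply: filterS => w ->; rewrite ge_min lexx orbT.
  by move=> /small/ge2eta; apply: filterS => w ge; rewrite ge_min ge.
move=> alpha alpha0 c1.
have [||q [L [q01 rec_le rec_ge]]] := recurrent_common r eta rho alpha c1.
- exact: consensus_recurrent (ltW alpha0).
- rewrite /c1; case: ifPn => [|/small eta1]; [exact: extreme|exact: spread].
exists q, L.+1%:R; split; [exact: q01|split; first by rewrite ltr0n].
move=> d Omega P xi x0 x001 mxi xieta A1 dV k t t0.
have S : hk_setting r eta rho P xi x0 by [].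
have tL0 : 0 <= t / L.+1%:R by rewrite divr_ge0.
(* The quotient is nonnegative, so the integer exponent is a natural number: the count of complete
   windows in [t]. *)
have -> : Num.floor (t / L.+1%:R) = Posz (Num.truncn (t / L.+1%:R)).
  by move: tL0; rewrite truncEfloor -floor_ge0; case: (Num.floor _).
rewrite -exprnP; apply: (tau_gap_bound r eta rho P xi x0 S alpha c1 q L.+1) => //.
by rewrite natrM -ler_pdivlMr ?ltr0n// truncn_le.
Qed.
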